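(* Let $\mathcal{J},\mathcal{K}$ be ideals on $\omega$. (1) If $\mathcal{I}=\mathcal{J}\otimes\mathcal{K}$ or $\mathcal{I}=\mathcal{J}\otimes\{\emptyset\}$, then $\mathfrak{b}_s(\mathrm{Fin},\mathcal{I},\mathcal{I})=\aleph_0$. (2) If $\mathcal{I}=\{\emptyset\}\otimes\mathcal{K}$, then $\mathfrak{b}_s(\mathrm{Fin},\mathcal{I},\mathcal{I})=\mathfrak{b}_s(\mathrm{Fin},\mathcal{K},\mathcal{K})$.
   Context: An ideal on a countable infinite set $X$ is a family $\mathcal{I}\subseteq\mathcal{P}(X)$ closed under finite unions and subsets, containing all finite subsets, with $X\notin\mathcal{I}$; $\mathrm{Fin}$ denotes the ideal of finite subsets of the relevant set. For $A\subseteq\omega\times\omega$ and $x\in\omega$, $(A)_x=\{y:(x,y)\in A\}$. For ideals $\mathcal{J},\mathcal{K}$ on $\omega$: $\mathcal{J}\otimes\mathcal{K}=\{A\subseteq\omega\times\omega:\{x:(A)_x\notin\mathcal{K}\}\in\mathcal{J}\}$, $\mathcal{J}\otimes\{\emptyset\}=\{A\subseteq\omega\times\omega:\{x:(A)_x\ne\emptyset\}\in\mathcal{J}\}$, $\{\emptyset\}\otimes\mathcal{K}=\{A\subseteq\omega\times\omega:(A)_x\in\mathcal{K}\text{ for all }x\}$. For an ideal $\mathcal{K}$ on $X$, $\widehat{\mathcal{P}}_{\mathcal{K}}$ is the family of sequences $\langle A_n:n\in\omega\rangle$ of pairwise disjoint members of $\mathcal{K}$, and $\mathcal{P}_{\mathcal{K}}$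 those with union $X$. For ideals $\mathcal{I},\mathcal{J},\mathcal{K}$ on $X$: $\mathfrak{b}_s(\mathcal{I},\mathcal{J},\mathcal{K})=\min\{|\mathcal{E}|:\mathcal{E}\subseteq\widehat{\mathcal{P}}_{\mathcal{K}},\ \forall\langle A_n\rangle\in\mathcal{P}_{\mathcal{J}}\ \exists\langle E_n\rangle\in\mathcal{E}\ \bigcup_n(A_{n+1}\cap\bigcup_{i\le n}E_i)\notin\mathcal{I}\}$, with $\min\emptyset=\mathfrak{c}^+$. *)

(* Defs.v *)
From mathcomp Require Import all_boot.
From mathcomp Require Import all_classical.
Set Implicit Arguments.
Unset Strict Implicit.
Unset Printing Implicit Defensive.
Local Open Scope classical_set_scope.
Local Open Scope card_scope.

Definition is_ideal (X : Type) (I : set (set X)) : Prop :=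
  [/\ forall A B, I A -> I B -> I (A `|` B),
      forall A B, A `<=` B -> I B -> I A,
      forall A, finite_set A -> I A
    & ~ I [set: X] ].

Definition Fin (X : Type) : set (set X) := [set A | finite_set A].
Arguments Fin X : clear implicits.

(* J ⊗ K *)
Definition ideal_prod (J K : set (set nat)) : set (set (nat * nat)) :=
  [set A | J [set x | ~ K (xsection A x)]].

(* J ⊗ {∅} *)
Definition ideal_prod_empr (J : set (set nat)) : set (set (nat * nat)) :=
  [set A | J [set x | xsection A x <> set0]].

(* {∅} ⊗ K *)
Definition ideal_prod_empl (K : set (set nat)) : set (set (nat * nat)) :=
  [set A | forall x, K (xsection A x)].

Definition Phat (X : Type) (K : set (set X)) : set (nat -> set X) :=
  [set A | trivIset setT A /\ forall n, K (A n)].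

Definition Ppart (X : Type) (K : set (set X)) : set (nat -> set X) :=
  [set A | Phat K A /\ \bigcup_n A n = [set: X]].

Definition bs_family (X : Type) (I J K : set (set X)) :
    set (set (nat -> set X)) :=
  [set E | E `<=` Phat K /\
    forall A, Ppart J A ->
      exists2 B, E B &
        ~ I (\bigcup_n (A n.+1 `&` \bigcup_(i in [set i | i <= n]) B i))].

(* Cardinals up to 2^c are represented by subsets of P(P(ω)), compared with
   #= and #<=; this is large enough to contain a representative of c^+. *)
Definition cardset := set (set (set nat)).

Definition is_cplus (C : cardset) : Prop :=
  ~ (C #<= [set: set nat]) /\
  forall D : cardset, ~ (D #<= [set: set nat]) -> C #<= D.

Definition is_min_card (T : Type) (F : set (set T)) (C : cardset) : Prop :=
  (exists2 E, F E & E #= C) /\ forall E, F E -> C #<= E.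

Definition is_bs (X : Type) (I J K : set (set X)) (C : cardset) : Prop :=
  (bs_family I J K !=set0 /\ is_min_card (bs_family I J K) C) \/
  (bs_family I J K = set0 /\ is_cplus C).

(* A set of cardinality b_s(I, J, K); it exists by [bsP] and is unique up to
   equipotence by [is_bs_uniq]. *)
Definition bs (X : countType) (I J K : set (set X)) : cardset :=
  xget set0 [set C | is_bs I J K C].

(* Cardinals are well-ordered: take a maximal set Y of choice functions for F
   on which every projection is injective; some projection is then onto. *)
Lemma min_card_ex (T : Type) (F : set (set T)) : F !=set0 ->
  exists2 C, F C & forall D, F D -> C #<= D.
Proof.
move=> F0.
pose P : set (set (set T -> T)) := [set Y |
  (forall y D, Y y -> F D -> D (y D)) /\
  (forall y z D, Y y -> Y z -> F D -> y D = z D -> y = z)].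
have [|Y [[Y1 Y2] maxY]] := @Zorn_bigcup _ P.
  move=> G GP tG; split=> [y D [Z GZ Zy] FD|y z D [Z GZ Zy] [W GW Ww] FD].
    by have [inD _] := GP _ GZ; exact: (inD y D).
  have [ZW|WZ] := tG _ _ GZ GW.
    by have [_ inj] := GP _ GW; apply: inj FD => //; exact: ZW.
  by have [_ inj] := GP _ GZ; apply: inj FD => //; exact: WZ.
have [[D FD sD]|nsD] :=
    pselect (exists2 D, F D & D `<=` (fun y => y D) @` Y).
  exists D => // E FE.
  apply: (card_le_trans (subset_card_le sD)).
  apply: (card_le_trans (card_image_le _ _)).
  have inj : {in Y &, injective (fun y : set T -> T => y E)}.
    by move=> y z /set_mem Yy /set_mem Yz /(Y2 _ _ E); apply.
  have := inj_card_eq inj; rewrite card_eq_le => /andP[_ /card_le_trans]; apply.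
  by apply: subset_card_le => _ [y Yy <-]; exact: (Y1 y E).
exfalso.
have ex D : F D -> exists2 d, D d & forall y, Y y -> y D <> d.
  move=> FD; apply: contrapT => nd; apply: nsD; exists D => // d Dd.
  apply: contrapT => nY; apply: nd; exists d => // y Yy yd.
  by apply: nY; exists y.
have [D0 FD0] := F0; have [t0 _ _] := ex _ FD0.
have /choice[f fP] : forall D, exists d, F D -> D d /\ forall y, Y y -> y D <> d.
  move=> D; have [/ex[d Dd dY]|nF] := pselect (F D); last by exists t0.
  by exists d.
have Yf : ~ Y f by move=> Yf; have [_ /(_ f Yf)] := fP _ FD0.
apply: (maxY (f |` Y)).
  by split=> [y Yy|/(_ f (or_introl erefl))]; [right|].
split=> [y D [->|Yy] FD|y z D [->|Yy] [->|Yz] FD yz] //.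
- by have [] := fP _ FD.
- exact: (Y1 y D).
- by have [_ /(_ _ Yz) []] := fP _ FD; rewrite yz.
- by have [_ /(_ _ Yy) []] := fP _ FD.
- exact: Y2 yz.
Qed.

Lemma is_cplus_ex : exists C, is_cplus C.
Proof.
have [|C C1 C2] := @min_card_ex (set (set nat))
  [set C | ~ (C #<= [set: set nat])]; last by exists C.
exists setT => /= /pcard_leTP/unsquash f.
pose S : set (set nat) := [set a | exists2 B, f B = a & ~ B a].
have [Sf|nSf] := pselect (S (f S)).
  by case: (Sf) => B /inj -/(_ (mem_setT _) (mem_setT _)) BS; rewrite BS.
by apply: (nSf); exists S.
Qed.

Lemma bsP (X : countType) (I J K : set (set X)) : is_bs I J K (bs I J K).
Proof.
suff [C CP] : exists C, is_bs I J K C by exact: (xgetI set0 CP).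
have [F0|nF0] := pselect (bs_family I J K !=set0); last first.
  have [C CP] := is_cplus_ex; exists C; right; split=> //.
  by apply/eqP; apply: contrapT => /negP/set0P.
have [E FE Emin] := min_card_ex F0.
pose f (s : nat -> set X) : set (set nat) :=
  [set [set k | exists n x, k = pickle (n, x) /\ s n x]].
have finj : {in E &, injective f}.
  move=> s t _ _ /seteqP[+ _] => /(_ _ erefl) /= st.
  apply/funext => n; apply/seteqP; split=> x sx.
  - have : [set k | exists n x, k = pickle (n, x) /\ s n x] (pickle (n, x)).
      by exists n, x.
    by rewrite st => -[m [y [/(pcan_inj pickleK)[-> ->]]]].
  - have : [set k | exists n x, k = pickle (n, x) /\ t n x] (pickle (n, x)).
      by exists n, x.
    by rewrite -st => -[m [y [/(pcan_inj pickleK)[-> ->]]]].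
have fE := inj_card_eq finj.
exists (f @` E); left; split=> //; split; first by exists E => //; rewrite card_eq_sym.
by move=> D FD; rewrite (card_le_eql fE); exact: Emin.
Qed.

Lemma is_bs_uniq (X : Type) (I J K : set (set X)) (C D : cardset) :
  is_bs I J K C -> is_bs I J K D -> C #= D.
Proof.
have le C' D' : is_bs I J K C' -> is_bs I J K D' -> C' #<= D'.
  move=> [[F0 [_ Cm]]|[F0 [_ Cm]]] [[F1 [[E FE ED] _]]|[F1 [nD _]]].
  - by rewrite -(card_le_eqr ED); exact: Cm.
  - by move: F0; rewrite F1 => -[].
  - by move: F1; rewrite F0 => -[].
  - exact: Cm.
by move=> hC hD; rewrite card_eq_le !le.
Qed.

(* Main.v *)
Require Import Defs.
From mathcomp Require Import all_boot.
From mathcomp Require Import all_classical.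
Local Open Scope classical_set_scope.
Local Open Scope card_scope.
Set Implicit Arguments.
Unset Strict Implicit.

(** Partitions of [X] into members of an ideal are functions [g : X -> nat] with
    fibres in the ideal, and a disjoint sequence [B] is a partial function.
    A family witnesses [b_s(Fin, I, I)] iff no [g] is, off a finite set, below
    every [B] of the family.  Finitely many [B] are bounded below by their
    pointwise minimum, so the invariant is infinite; for [J ⊗ K] and [J ⊗ {∅}]
    the columns form a countable witness, because a [g] below all of them has a
    fibre over [0] that is cofinite in each column.

    For [{∅} ⊗ K], a witness on [nat] is transported to the column [x = 0].
    Conversely, [f] on [nat * nat] is sent to [f' y = min_x max(x, f(x, y))].  If
    [g] is almost below [f'], put [G(x, y) = g y] when [x < g y] and [0]
    otherwise.  A point with [f(x, y) < G(x, y)] satisfies [f' y < g y] and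
    [x < g y], so there are finitely many of them. *)

(** * Closure properties of ideals *)

Section Ideals.
Context (X : Type) (I : set (set X)) (hI : is_ideal I).

Lemma ideal_setU (A B : set X) : I A -> I B -> I (A `|` B).
Proof. by case: hI => U _ _ _; exact: U. Qed.

Lemma ideal_subset (A B : set X) : A `<=` B -> I B -> I A.
Proof. by case: hI => _ S _ _; exact: S. Qed.

Lemma ideal_finite (A : set X) : finite_set A -> I A.
Proof. by case: hI => _ _ F _; exact: F. Qed.

Lemma ideal_neqT (A : set X) : I A -> A <> [set: X].
Proof. by case: hI => _ _ _ nT IA AT; apply: nT; rewrite -AT. Qed.

Lemma ideal_bigcup_finite (T : Type) (D : set T) (F : T -> set X) :
  finite_set D -> (forall i, D i -> I (F i)) -> I (\bigcup_(i in D) F i).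
Proof.
(* A choice structure on [T] lets the finite set [D] be listed by a sequence. *)
elim/Pchoice: T => T in D F *.
move=> /finite_seqP[s ->]; elim: s => [|a s IHs] IF.
  by apply: ideal_finite; rewrite set_nil bigcup_set0.
apply: (@ideal_subset _ (F a `|` \bigcup_(i in [set` s]) F i)).
  move=> x [i /=]; rewrite inE => /orP[/eqP ->|si] Fx; first by left.
  by right; exists i.
apply: ideal_setU; first by apply: IF; rewrite /= mem_head.
by apply: IHs => i /= si; apply: IF; rewrite /= inE si orbT.
Qed.

Lemma ideal_cofinite (A : set X) : finite_set (~` A) -> ~ I A.
Proof.
move=> fA IA; apply: (@ideal_neqT (A `|` ~` A)); last exact: setUv.
by apply: ideal_setU => //; exact: ideal_finite.
Qed.

End Ideals.

(** * The product families are ideals *)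

Section Products.
Implicit Types (J K : set (set nat)) (A : set (nat * nat)).

Lemma xsectionU A B (x : nat) :
  xsection (A `|` B) x = xsection A x `|` xsection B x.
Proof. by rewrite !xsectionE. Qed.

Lemma finite_xsection A (x : nat) : finite_set A -> finite_set (xsection A x).
Proof.
move=> fA; apply: sub_finite_set (finite_image snd fA) => y.
by rewrite xsectionE => Axy; exists (x, y).
Qed.

Lemma ideal_prod_is_ideal J K :
  is_ideal J -> is_ideal K -> is_ideal (ideal_prod J K).
Proof.
move=> hJ hK; split=> [A B JA JB|A B AB JB|A fA|JT].
- apply: (ideal_subset hJ _ (ideal_setU hJ JA JB)) => // x /= nU.
  have [KA|] := pselect (K (xsection A x)); last by left.
  by right=> KB; apply: nU; rewrite xsectionU; exact: ideal_setU.
- apply: (ideal_subset hJ _ JB) => // x /= nA KB; apply: nA.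
  by apply: ideal_subset KB => //; exact: le_xsection.
- apply: (ideal_subset hJ _ (ideal_finite hJ (finite_set0 _))) => // x /=; apply.
  by apply: ideal_finite => //; exact: finite_xsection.
- apply: (ideal_neqT hJ JT); apply/seteqP; split=> // x _ /= KT.
  by apply: (ideal_neqT hK KT); apply/seteqP; split=> // y _; rewrite xsectionE.
Qed.

Lemma ideal_prod_empr_is_ideal J :
  is_ideal J -> is_ideal (ideal_prod_empr J).
Proof.
move=> hJ; split=> [A B JA JB|A B AB JB|A fA|JT].
- apply: (ideal_subset hJ _ (ideal_setU hJ JA JB)) => // x /= nU.
  have [A0|] := pselect (xsection A x = set0); last by left.
  by right=> B0; apply: nU; rewrite xsectionU A0 B0 setU0.
- apply: (ideal_subset hJ _ JB) => // x /= nA B0; apply: nA.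
  by rewrite -subset0 -B0; exact: le_xsection.
- apply: (ideal_finite hJ); apply: sub_finite_set (finite_image fst fA) => x /=.
  move=> /eqP/set0P[y]; rewrite xsectionE => Axy.
  by exists (x, y).
- apply: (ideal_neqT hJ JT); apply/seteqP; split=> // x _ /= /seteqP[+ _].
  by move=> /(_ 0); rewrite xsectionE; exact.
Qed.

End Products.

Definition exceeds (X : Type) (g : X -> nat) (B : nat -> set X) : set X :=
  [set x | exists2 i, i < g x & B i x].

(** With [A n] the fibre of [g] over [n], a point lies in [A n.+1] and in some [B i] with [i <= n]
    exactly when [g x = n.+1] and [i < g x]. *)
Lemma bs_familyE (X : Type) (J K : set (set X)) (E : set (nat -> set X)) :
  bs_family (Fin X) J K E <->
  E `<=` Phat K /\ forall g : X -> nat, (forall n, J (g @^-1` [set n])) ->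
    exists2 B, E B & infinite_set (exceeds g B).
Proof.
have exE (g : X -> nat) (B : nat -> set X) : \bigcup_n
    (g @^-1` [set n.+1] `&` \bigcup_(i in [set i | i <= n]) B i) = exceeds g B.
  apply/seteqP; split=> [x [n _ [/= gx [i /= ilen Bix]]]|x [i ig Bix]].
    by exists i => //; rewrite gx ltnS.
  exists (g x).-1 => //; split=> /=; first by rewrite (ltn_predK ig).
  by exists i => //=; rewrite -ltnS (ltn_predK ig).
split=> -[EK EP]; (split=> //); [move=> g Jg|move=> A [[tA JA] cA]].
  have [|B EB] := EP (fun n => g @^-1` [set n]); last by rewrite exE; exists B.
  split; first by split=> //; move=> m n _ _ [x [/= <- <-]].
  by apply/seteqP; split=> // x _; exists (g x).
have /choice[g gA] : forall x, exists n, A n x.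
  by move=> x; have : [set: X] x by []; rewrite -cA => -[n _ Anx]; exists n.
have AE : A = fun n => g @^-1` [set n].
  apply/funext => n; apply/seteqP; split=> [x Anx|x /= <- //].
  by apply: tA => //; exists x.
have [|B EB infB] := EP g; last by exists B => //; rewrite AE exE.
by move=> n; have := JA n; rewrite AE.
Qed.

Lemma bs_family_infinite (X : countType) (I : set (set X))
    (E : set (nat -> set X)) :
  is_ideal I -> bs_family (Fin X) I I E -> infinite_set E.
Proof.
move=> hI /bs_familyE[EI EP] finE.
(* The value [pickle x] bounds [g] where no [B] is defined, and adds at most one point to each
   fibre. *)
pose P x n := (n = pickle x) \/ exists2 B, E B & B n x.
have /choice[g gP] : forall x, exists n, P x n /\ forall m, P x m -> n <= m.
  move=> x; have exP : exists n, `[< P x n >].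
    by exists (pickle x); apply/asboolP; left.
  case: (ex_minnP exP) => n /asboolP Pn minn; exists n; split=> // m Pm.
  by apply: minn; apply/asboolP.
have [n|B EB] := EP g; last first.
  apply; apply: sub_finite_set (finite_set0 X) => x [i ig Bix].
  have [_ gmin] := gP x; move: ig; rewrite ltnNge gmin //.
  by right; exists B.
apply: (@ideal_subset _ _ hI _
  ([set x | pickle x = n] `|` \bigcup_(B in E) B n)).
  by move=> x /= <-; have [[<-|[B EB Bx]] _] := gP x; [left|right; exists B].
apply: ideal_setU => //; last first.
  by apply: ideal_bigcup_finite => // B /EI[_]; exact.
apply: ideal_finite => //.
have [[x xn]|nx] := pselect (exists x : X, pickle x = n).
  apply: sub_finite_set (finite_set1 x) => y /= yn.
  by apply: (pcan_inj pickleK); rewrite xn.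
by apply: sub_finite_set (finite_set0 X) => y yn; apply: nx; exists y.
Qed.

(** * Countable witnesses from columns *)

Definition column (k n : nat) : set (nat * nat) :=
  [set p | n = 0 /\ p.1 = k].

(** If [g] exceeds each column only finitely often, its fibre over [0] is cofinite in every column,
    so it is not in [I]. *)
Lemma range_column_bs_family (I : set (set (nat * nat))) :
  (forall k n, I (column k n)) ->
  (forall A, (forall x, finite_set (~` xsection A x)) -> ~ I A) ->
  bs_family (Fin _) I I (range column).
Proof.
move=> Icol Icof; apply/bs_familyE; split=> [_ [k _ <-]|g Ig].
  by split=> // m n _ _ [p [[-> _] [-> _]]].
apply: contrapT => nB; apply: Icof (Ig 0) => x.
have fx : finite_set (exceeds g (column x)).
  by apply: contrapT => infx; apply: nB; exists (column x) => //; exists x.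
apply: sub_finite_set (finite_image snd fx) => y /=.
rewrite xsectionE /= => /eqP; rewrite -lt0n => gxy.
by exists (x, y) => //; exists 0.
Qed.

Lemma bs_countable (I : set (set (nat * nat))) :
  is_ideal I -> (forall k n, I (column k n)) ->
  (forall A, (forall x, finite_set (~` xsection A x)) -> ~ I A) ->
  bs (Fin (nat * nat)) I I #= [set: nat].
Proof.
move=> hI Icol Icof; have colF := range_column_bs_family Icol Icof.
case: (bsP (Fin (nat * nat)) I I) => [[_ [[E FE EC] Cmin]]|[F0 _]]; last first.
  by move: colF; rewrite F0.
rewrite card_eq_le; apply/andP; split.
  exact: card_le_trans (Cmin _ colF) (card_image_le _ _).
by rewrite -(card_le_eqr EC) -infiniteP; exact: bs_family_infinite FE.
Qed.

(** Two transports are needed even for one inequality: if one side has no witness then neither has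
    the other, and both values are the successor of the continuum. *)
Lemma bs_eq (X Y : countType) (I J K : set (set X)) (I' J' K' : set (set Y)) :
  (forall E, bs_family I J K E ->
     exists2 E', bs_family I' J' K' E' & E' #<= E) ->
  (forall E, bs_family I' J' K' E ->
     exists2 E', bs_family I J K E' & E' #<= E) ->
  bs I J K #= bs I' J' K'.
Proof.
move=> h1 h2.
have le (X1 X2 : countType) (I1 J1 K1 : set (set X1)) (I2 J2 K2 : set (set X2)) :
    (forall E, bs_family I1 J1 K1 E ->
       exists2 E', bs_family I2 J2 K2 E' & E' #<= E) ->
    (forall E, bs_family I2 J2 K2 E ->
       exists2 E', bs_family I1 J1 K1 E' & E' #<= E) ->
    bs I1 J1 K1 #<= bs I2 J2 K2.
  move=> h12 h21.
  case: (bsP I2 J2 K2) => [[_ [[E FE EC] _]]|[F2 [nC _]]].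
    have [E' FE' E'E] := h21 _ FE.
    case: (bsP I1 J1 K1) => [[_ [_ Cmin]]|[F1 _]]; last first.
      by move: FE'; rewrite F1.
    by rewrite -(card_le_eqr EC); exact: card_le_trans (Cmin _ FE') E'E.
  case: (bsP I1 J1 K1) => [[[E /h12[E' ]]]|[_ [_ Cmin]]]; last exact: Cmin.
  by rewrite F2.
by rewrite card_eq_le !le.
Qed.

(** * Transport of witnesses between [nat] and [nat * nat] *)

Definition embed_column (B : nat -> set nat) (n : nat) : set (nat * nat) :=
  [set p | p.1 = 0 /\ B n p.2].

Lemma embed_column_bs_family (K : set (set nat)) (E : set (nat -> set nat)) :
  is_ideal K -> bs_family (Fin nat) K K E ->
  bs_family (Fin (nat * nat)) (ideal_prod_empl K) (ideal_prod_empl K)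
    (embed_column @` E).
Proof.
move=> hK /bs_familyE[EK EP]; apply/bs_familyE.
split=> [_ [B /EK[tB KB] <-]|g Kg].
  split=> [m n _ _ [p [[_ Bm] [_ Bn]]]|n x].
    by apply: tB => //; exists p.2.
  by apply: ideal_subset (KB n) => // y; rewrite xsectionE => -[].
have [n|B EB infB] := EP (fun y => g (0, y)).
  by apply: ideal_subset (Kg n 0) => // y; rewrite xsectionE.
exists (embed_column B); first by exists B.
apply: contra_not infB => fB.
apply: sub_finite_set (finite_image snd fB) => y [i ig Biy].
by exists (0, y) => //; exists i.
Qed.

(* [below B n] is [f' <= n] for [f' y = min_x max(x, f(x, y))], where [f] is the
   partial function with fibres [B]. *)
Definition below (B : nat -> set (nat * nat)) (n : nat) : set nat :=
  [set y | exists x i, [/\ x <= n, i <= n & B i (x, y)]].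

(** The fibre of [f'] over [n]. *)
Definition diagonal_min (B : nat -> set (nat * nat)) (n : nat) : set nat :=
  [set y | below B n y /\ forall m, below B m y -> n <= m].

Lemma diagonal_min_Phat (K : set (set nat)) (B : nat -> set (nat * nat)) :
  is_ideal K -> Phat (ideal_prod_empl K) B -> Phat K (diagonal_min B).
Proof.
move=> hK [_ KB]; split=> [m n _ _ [y [[bm minm] [bn minn]]]|n].
  by apply/eqP; rewrite eqn_leq minm ?minn.
(* The maximum with [x] in [f'] leaves only finitely many columns to cover the fibre. *)
apply: (@ideal_subset _ _ hK _
  (\bigcup_(x in `I_n.+1) \bigcup_(i in `I_n.+1) xsection (B i) x)).
  move=> y [[x [i [xn in_ Bi]]] _]; exists x => //; exists i => //.
  by rewrite xsectionE.
apply: ideal_bigcup_finite => // x _; apply: ideal_bigcup_finite => // i _.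
exact: KB.
Qed.

Lemma diagonal_min_le (B : nat -> set (nat * nat)) (x y i : nat) :
  B i (x, y) -> exists2 n, n <= maxn x i & diagonal_min B n y.
Proof.
move=> Bi; have bxi : below B (maxn x i) y.
  by exists x, i; rewrite leq_maxl leq_maxr.
have exb : exists n, `[< below B n y >] by exists (maxn x i); apply/asboolP.
case: (ex_minnP exb) => n /asboolP bn minn; exists n.
  by apply: minn; apply/asboolP.
by split=> // m bm; apply: minn; apply/asboolP.
Qed.

Lemma diagonal_min_bs_family (K : set (set nat))
    (E : set (nat -> set (nat * nat))) :
  is_ideal K ->
  bs_family (Fin (nat * nat)) (ideal_prod_empl K) (ideal_prod_empl K) E ->
  bs_family (Fin nat) K K (diagonal_min @` E).
Proof.
move=> hK /bs_familyE[EK EP]; apply/bs_familyE.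
split=> [_ [B /EK PB <-]|g Kg]; first exact: diagonal_min_Phat.
pose G (p : nat * nat) := if p.1 < g p.2 then g p.2 else 0.
have [n x|B EB infB] := EP G.
  (* The default [0] is taken on column [x] only where [g y <= x], a finite union of fibres of
     [g]. *)
  apply: (@ideal_subset _ _ hK _
    (g @^-1` [set n] `|` \bigcup_(m in `I_x.+1) g @^-1` [set m])).
    move=> y; rewrite xsectionE /G /=.
    by case: ltnP => [_ <-|gx _]; [left|right; exists (g y)].
  by apply: ideal_setU => //; exact: ideal_bigcup_finite.
exists (diagonal_min B); first by exists B.
apply: contra_not infB => fS.
(* From [i < G (x, y)] follows [maxn x i < g y]: such [y] are finite in number, and each allows only
   [x < g y]. *)
apply: (@sub_finite_set _ _
  (\bigcup_(y in exceeds g (diagonal_min B)) ((fun x => (x, y)) @` `I_(g y)))).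
  move=> [x y] [i]; rewrite /G /=; case: (ltnP x) => // xg ig Bi.
  have [n nxi dn] := diagonal_min_le Bi.
  exists y; last by exists x.
  by exists n => //; rewrite (leq_ltn_trans nxi) // gtn_max xg.
by apply: bigcup_finite => // y _; apply: finite_image; exact: finite_II.
Qed.

Unset Implicit Arguments.

Theorem theorem5p5 (J K : set (set nat)) (hJ : is_ideal J) (hK : is_ideal K) :
  (forall I : set (set (nat * nat)),
     I = ideal_prod J K \/ I = ideal_prod_empr J ->
     bs (Fin (nat * nat)) I I #= [set: nat]) /\
  (forall I : set (set (nat * nat)),
     I = ideal_prod_empl K ->
     bs (Fin (nat * nat)) I I #= bs (Fin nat) K K).
Proof.
have col0 k n x : x <> k -> xsection (column k n) x = set0.
  by move=> xk; apply/seteqP; split=> // y; rewrite xsectionE => -[].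
split=> [I [->|->]|I ->].
- apply: bs_countable => [|k n|A cofA JA]; first exact: ideal_prod_is_ideal.
    apply: (ideal_finite hJ); apply: sub_finite_set (finite_set1 k) => x /= nK.
    apply: contrapT => /col0 x0; apply: nK; rewrite x0.
    exact: (ideal_finite hK (finite_set0 _)).
  (* Cofinite sections lie outside [K], so the index set that should be in [J] is everything. *)
  apply: (ideal_neqT hJ JA); apply/seteqP; split=> // x _.
  exact: ideal_cofinite.
- apply: bs_countable => [|k n|A cofA JA]; first exact: ideal_prod_empr_is_ideal.
    apply: (ideal_finite hJ); apply: sub_finite_set (finite_set1 k) => x /= n0.
    by apply: contrapT => /col0.
  apply: (ideal_neqT hJ JA); apply/seteqP; split=> // x _ /= x0.
  by have := cofA x; rewrite x0 setC0; exact: infinite_nat.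
- apply: bs_eq => E FE.
    exists (diagonal_min @` E); last exact: card_image_le.
    exact: diagonal_min_bs_family.
  exists (embed_column @` E); last exact: card_image_le.
  exact: embed_column_bs_family.
Qed.
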